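(* Let $n\ge2$ and let $a_1,\dots,a_{n+1}$, $B_n$, $C_n$ be as in the context. Let $m=\max B_n$ and $\mu=a_{[1,n+1]}$, and set $I_{B_n}=\langle X^{m-b}Y^b: b\in B_n\rangle$ and $I_{C_n}=\langle X^{\mu-c}Y^c:c\in C_n\rangle$. Then: (1) $I_{B_n}$ is an atom of $\mathcal I(R)$; (2) $\{2,n+1\}\subseteq\mathsf L_{\mathcal I(R)}(I_{C_n})\subseteq[2,n+1]$.
   Context: Let $D$ be an integral domain, $N\ge2$, $R=D[X_1,\dots,X_N]$, $X=X_1$, $Y=X_2$. $\mathcal I(R)$ denotes the monoid of nonzero ideals of $R$ under ideal multiplication (identity $R$, whose only unit is $R$). Standing assumption: $\mathcal I(R)$ is a BF-monoid. An atom of $\mathcal I(R)$ is an ideal $I\in\mathcal I(R)$, $I\ne R$, such that $I=\mathfrak a\mathfrak b$ with $\mathfrak a,\mathfrak b\in\mathcal I(R)$ forces $\mathfrak a=R$ or $\mathfrak b=R$. $\mathsf L_{\mathcal I(R)}(I)$ is the set of all $k$ such that $I$ is a product of $k$ atoms of $\mathcal I(R)$. $[x,y]=\{z\in\mathbb Z:x\le z\le y\}$. Fix an integer $n\ge2$ and positive integers $a_1,\dots,a_{n+1}$ with (C1) $a_{n+1}=a_1+\dots+a_{n-1}+2a_n$ and (C2) $a_{i+1}>2(a_1+\dots+a_i)$ for all $i\in[1,n-1]$. For $I\subseteq[1,n+1]$ put $a_I=\sum_{i\in I}a_i$ ($a_\emptyset=0$). Define $A_n=\{a_I:I\subseteq[1,n-1]\}$,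 $B_n=A_n\cup\{a_{[1,n]}\}\cup(A_n+a_{n+1})$, $C_n=\{a_I:I\subseteq[1,n+1]\}$. *)

(* Defs.v *)
From mathcomp Require Import all_boot all_algebra.
From mathcomp Require Import mpoly.
Set Implicit Arguments. Unset Strict Implicit. Unset Printing Implicit Defensive.
Import GRing.Theory.
Local Open Scope ring_scope.

Section Ideals.
Variable T : comPzRingType.

Definition is_ideal (I : T -> Prop) : Prop :=
  I 0 /\ (forall x y, I x -> I y -> I (x + y)) /\ (forall r x, I x -> I (r * x)).

Definition nonzero_ideal (I : T -> Prop) : Prop := exists x, I x /\ x != 0.

Definition ideq (I J : T -> Prop) : Prop := forall x, I x <-> J x.

Definition whole : T -> Prop := fun _ => True.

Definition imul (I J : T -> Prop) : T -> Prop := fun x =>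
  exists s : seq (T * T), (forall p, p \in s -> I p.1 /\ J p.2) /\
    x = \sum_(p <- s) p.1 * p.2.

Definition iprod (s : seq (T -> Prop)) : T -> Prop := foldr imul whole s.

Definition gen_ideal (P : T -> Prop) : T -> Prop := fun x =>
  exists s : seq (T * T), (forall p, p \in s -> P p.2) /\
    x = \sum_(p <- s) p.1 * p.2.

Definition in_IR (I : T -> Prop) : Prop := is_ideal I /\ nonzero_ideal I.

Definition is_atom (I : T -> Prop) : Prop :=
  in_IR I /\ ~ ideq I whole /\
  forall A B, in_IR A -> in_IR B -> ideq I (imul A B) -> ideq A whole \/ ideq B whole.

Definition in_lengths (I : T -> Prop) (k : nat) : Prop :=
  exists s : seq (T -> Prop), size s = k /\
    (forall i, (i < size s)%N -> is_atom (nth whole s i)) /\ ideq I (iprod s).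

Definition IR_is_BF : Prop :=
  forall I, in_IR I -> ~ ideq I whole ->
    (exists k, in_lengths I k) /\ (exists M, forall k, in_lengths I k -> (k <= M)%N).

End Ideals.

(* a : nat -> nat, with a i = a_i for i in [1, n+1] *)
Definition subset_sum (a : nat -> nat) (lo hi : nat) (f : nat -> bool) : nat :=
  (\sum_(lo <= i < hi) (if f i then a i else 0))%N.

Definition inA (a : nat -> nat) (n b : nat) : Prop :=
  exists f : nat -> bool, b = subset_sum a 1 n f.

Definition aint (a : nat -> nat) (k : nat) : nat := (\sum_(1 <= i < k.+1) a i)%N.

Definition inB (a : nat -> nat) (n b : nat) : Prop :=
  inA a n b \/ b = aint a n \/ (exists b', inA a n b' /\ b = (b' + a n.+1)%N).

Definition inC (a : nat -> nat) (n c : nat) : Prop :=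
  exists f : nat -> bool, c = subset_sum a 1 n.+2 f.

(* ---------- the variables X = X_1, Y = X_2 of D[X_1,...,X_N] ---------- *)
Definition varX (N : nat) (hN : (1 < N)%N) : 'I_N := Ordinal (ltnW hN).
Definition varY (N : nat) (hN : (1 < N)%N) : 'I_N := Ordinal hN.

Definition mono_ideal (D : idomainType) (N : nat) (hN : (1 < N)%N)
    (S : nat -> Prop) (m : nat) : {mpoly D[N]} -> Prop :=
  gen_ideal (fun g : {mpoly D[N]} => exists b, S b /\
     g = 'X_(varX hN) ^+ (m - b) * 'X_(varY hN) ^+ b).

(* Main.v *)
(* For a nonzero ideal [A] take the forms of least degree in [X] and [Y] of its
   elements and dehomogenize them to polynomials in [Y]; let [P A] be the set of
   the orders at [Y = 0] of those. Then [P A + P A'] is contained in [P (A A')],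
   and [P] recovers the exponent set of a monomial ideal. If [A A'] is the monomial
   ideal of [B], then echelon bases of the two modules of lowest forms show that
   every [e] in [B] lies in [P A + P A'], provided that the pairs in [P A * P A']
   with sum at most [e] have distinct sums. Applied to [e = max B] this gives
   [A = R] as soon as [P A = {0}].

   If [a_[1,n]] is in neither [P A] nor [P A'], everything takes place among the
   subset sums of the superincreasing sequence [a_1, ..., a_(n-1), a_(n+1)], where
   sums are unique; so [a_[1,n]] would lie in [P A + P A'], which the gaps of [B_n]
   forbid. Otherwise [P A] or [P A'] is [{0}], or both are [{0, a_[1,n]}] and
   [e = a_1] gives a contradiction.

   In a product of [k] atoms equal to [I_(C_n)] every factor has a positive order
   [p_i], all subset sums of the [p_i] lie in [C_n], and so [k <= n + 1]. *)
Require Import Defs.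
From mathcomp Require Import all_boot all_algebra.
From mathcomp Require Import mpoly.
From mathcomp Require Import zify ring.
From Stdlib Require Import Classical ClassicalEpsilon.

Set Implicit Arguments.
Unset Strict Implicit.
Unset Printing Implicit Defensive.

(** * Subset sums of superincreasing sequences *)

Section SubsetSums.
Local Open Scope nat_scope.

Definition sums (a : nat -> nat) (t c : nat) : Prop :=
  exists f : nat -> bool, c = subset_sum a 1 t f.

Definition superincreasing (a : nat -> nat) (t : nat) : Prop :=
  forall i, 1 <= i < t -> 2 * (\sum_(1 <= j < i) a j) < a i.

Lemma sums_recr a t c : 0 < t ->
  sums a t.+1 c <-> sums a t c \/ exists c', sums a t c' /\ c = c' + a t.
Proof.
move=> t0; split.
  move=> [f ->]; rewrite /subset_sum big_nat_recr //=.
  by case: (f t); [right; exists (subset_sum a 1 t f); split=> //; exists f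
                  | left; exists f; rewrite addn0].
have ext (f : nat -> bool) b :
    subset_sum a 1 t.+1 (fun i => if i == t then b else f i) =
    subset_sum a 1 t f + (if b then a t else 0).
  rewrite /subset_sum big_nat_recr //= eqxx; congr (_ + _).
  by apply: eq_big_nat => i /andP[_ it]; rewrite ltn_eqF.
case=> [[f ->]|[_ [[f ->] ->]]].
  by exists (fun i => if i == t then false else f i); rewrite ext addn0.
by exists (fun i => if i == t then true else f i); rewrite ext.
Qed.

Lemma sums_le a t c : sums a t c -> c <= \sum_(1 <= j < t) a j.
Proof. by move=> [f ->]; apply: leq_sum => i _; case: (f i). Qed.

Lemma sums0 a t : sums a t 0.
Proof. by exists xpred0; rewrite /subset_sum big1. Qed.

Lemma sums_total a t : sums a t (\sum_(1 <= j < t) a j).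
Proof. by exists xpredT. Qed.

Lemma sums_low a t c : 0 < t -> sums a t.+1 c -> c < a t -> sums a t c.
Proof. by move=> t0 /sums_recr-/(_ t0)[//|[c' [_ ->]]]; lia. Qed.

Lemma sums_high a t c : 0 < t -> sums a t.+1 c ->
  \sum_(1 <= j < t) a j < c -> a t <= c /\ sums a t (c - a t).
Proof.
move=> t0 /sums_recr-/(_ t0)[/sums_le|[c' [h ->]]]; first lia.
by rewrite addnK leq_addl.
Qed.

Lemma sum_recr (a : nat -> nat) t : 0 < t ->
  \sum_(1 <= j < t.+1) a j = \sum_(1 <= j < t) a j + a t.
Proof. by move=> t0; rewrite big_nat_recr. Qed.

Lemma superincreasingW a t : superincreasing a t.+1 -> superincreasing a t.
Proof. by move=> h i /andP[i1 it]; apply: h; rewrite i1 ltnW. Qed.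

(* In terms of index sets: if every sum is a disjoint union and
   [I + J = I' + J'], [I # J'], [I' # J], then [I = I']. *)
Lemma sums_cross a t x y x' y' : superincreasing a t ->
  sums a t x -> sums a t y -> sums a t x' -> sums a t y' ->
  sums a t (x + y) -> sums a t (x + y') -> sums a t (x' + y) ->
  x + y = x' + y' -> x = x'.
Proof.
elim: t x y x' y' => [|t IH] x y x' y' si.
  by move=> /sums_le hx _ /sums_le hx'; move: hx hx'; rewrite big_geq //; lia.
have [->|t0] := posnP t.
  by move=> /sums_le hx _ /sums_le hx'; move: hx hx'; rewrite big_geq //; lia.
have big2 : 2 * (\sum_(1 <= j < t) a j) < a t by apply: si; lia.
move=> hx hy hx' hy' hxy hxy' hx'y e.
have {}IH := IH _ _ _ _ (superincreasingW si).
have le := sum_recr a t0.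
have lxy := sums_le hxy; have lxy' := sums_le hxy'; have lx'y := sums_le hx'y.
have hi c : sums a t.+1 c -> a t <= c -> sums a t (c - a t).
  by move=> hc ac; apply: (sums_high t0 hc _).2; lia.
have lo c : sums a t.+1 c -> c < a t -> c <= \sum_(1 <= j < t) a j.
  by move=> hc ac; apply/sums_le/(sums_low t0 hc).
have L := lo _ _; have low := @sums_low a t.
have hx'y' : sums a t.+1 (x' + y') by rewrite -e.
(* [2 * a t] exceeds the total, so two numbers whose sum is a subset sum are not both at least
   [a t]. What survives: [a t] is used by [x] and [x'], by [y] and [y'], or by none. *)
case: (leqP (a t) x) => cx; case: (leqP (a t) y) => cy;
  case: (leqP (a t) x') => cx'; case: (leqP (a t) y') => cy'; try (
    have ? := lo x hx; have ? := lo y hy; have ? := lo x' hx';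
    have ? := lo y' hy'; lia).
- have := IH (x - a t) y (x' - a t) y'.
  have -> : x - a t + y = x + y - a t by lia.
  have -> : x - a t + y' = x + y' - a t by lia.
  have -> : x' - a t + y = x' + y - a t by lia.
  move=> H; suff : x - a t = x' - a t by lia.
  by apply: H; [exact: hi|exact: low|exact: hi|exact: low|
    apply: hi => //; lia|apply: hi => //; lia|apply: hi => //; lia|lia].
- have := IH x (y - a t) x' (y' - a t).
  have -> : x + (y - a t) = x + y - a t by lia.
  have -> : x + (y' - a t) = x + y' - a t by lia.
  have -> : x' + (y - a t) = x' + y - a t by lia.
  move=> H; apply: H;
    by [exact: hi|exact: low|apply: hi => //; lia|lia].
have lx := lo x hx cx; have ly := lo y hy cy.
have lx' := lo x' hx' cx'; have ly' := lo y' hy' cy'.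
by apply: (IH x y x' y') => //; apply: low => //; lia.
Qed.

Lemma sumn_rem (x : nat) s : x \in s -> sumn s = x + sumn (rem x s).
Proof. by move=> xs; rewrite (perm_sumn (perm_to_rem xs)). Qed.

Lemma sumn_subseq q p : subseq q p -> sumn q <= sumn p.
Proof.
elim: p q => [|y p IH] [|x q] //=; case: eqP => [->|_] /IH /=; last lia.
by rewrite leq_add2l.
Qed.

(* The elements of [p] behave like sums over pairwise disjoint nonempty index
   sets; if there are as many as indices, these sets are all the singletons. *)
Lemma size_le_sums a t (p : seq nat) : 0 < t -> superincreasing a t ->
  all (leq 1) p -> (forall q, subseq q p -> sums a t (sumn q)) ->
  size p < t /\ (size p = t.-1 -> \sum_(1 <= j < t) a j <= sumn p).
Proof.
elim: t p => [//|t IH] p _ si pos hp.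
have [t0|t0] := posnP t.
  have := sums_le (hp p (subseq_refl p)); rewrite t0 big_geq // leqn0.
  case: p pos {hp} => [|x p] /=; first by move=> _ _; split=> // _; rewrite big_geq.
  by move=> /andP[x0 _]; rewrite addn_eq0 gtn_eqF.
have big2 : 2 * (\sum_(1 <= j < t) a j) < a t by apply: si; lia.
have {}IH q := IH q t0 (superincreasingW si).
have sr := sum_recr a t0.
(* If some [x] is at least [a t], the other elements add up to less than [a t], so their sums do not
   use index [t]. *)
have [/hasP[x xp ax]|/hasPn small] := boolP (has (leq (a t)) p).
  have total := sums_le (hp p (subseq_refl p)).
  have sx := sumn_rem xp.
  have rem_sub := rem_subseq x p.
  case: (IH (rem x p)).
  - by apply/allP => y /mem_rem; apply/allP.
  - move=> q qs; apply: sums_low => //; first exact/hp/(subseq_trans qs).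
    by have := sumn_subseq qs; lia.
  rewrite size_rem // => h1 h2; split; first by case: (p) h1.
  move=> /= sp; rewrite sp in h2; have := h2 erefl. lia.
(* Here each element is at most the sum of the terms before [a t]. Adding one to a sum with the same
   bound gives at most twice that bound, still below [a t]. *)
have {}hp q : subseq q p -> sums a t (sumn q).
  elim: q => [|x q IHq] qp; first exact: sums0.
  have xp : x \in p by apply: (mem_subseq qp); rewrite mem_head.
  have lx : x < a t by rewrite ltnNge; apply: small.
  have /sums_le lq := IHq (subseq_trans (subseq_cons q x) qp).
  have /sums_low-/(_ t0 lx)/sums_le lx' : sums a t.+1 x.
    by have := hp [:: x]; rewrite /= addn0 sub1seq; apply.
  by apply: sums_low => //; [exact: hp | rewrite /=; lia].
by have [h _] := IH p pos hp; split; lia.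
Qed.

(* For a factorization of the span of the monomials [Y^b], [b] in [B], the sets
   [P] and [Q] of orders of the two factors satisfy this; the last clause is the
   conclusion of [orders_of_monomial]. *)
Definition splits (P Q B : nat -> Prop) : Prop :=
  P 0 /\ Q 0 /\ (forall p q, P p -> Q q -> B (p + q)) /\
  forall e, B e ->
    (forall p q p' q', P p -> Q q -> P p' -> Q q' ->
       p + q = p' + q' -> p + q <= e -> p = p') ->
    exists p q, P p /\ Q q /\ e = p + q.

Lemma splits_sym P Q B : splits P Q B -> splits Q P B.
Proof.
move=> [P0 [Q0 [add div]]]; split=> //; split=> //.
split=> [q p hq hp|e he inj]; first by rewrite addnC; apply: add.
have [|p [q [hp [hq ->]]]] := div e he; last by exists q, p; rewrite addnC.
move=> p q p' q' hp hq hp' hq' epq le.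
by have := inj q p q' p' hq hp hq' hp'; rewrite ![_ + p]addnC ![_ + p']addnC; lia.
Qed.

(** A nonzero [p] in [P] and a nonzero [q] in [Q] would both equal [c], but then [p + q] is neither
    0 nor [c]. *)
Lemma splits_pair c P Q : 0 < c -> splits P Q (fun b => b = 0 \/ b = c) ->
  (forall p, P p -> p = 0) \/ (forall q, Q q -> q = 0).
Proof.
move=> c0 [P0 [Q0 [add _]]].
have [[p hp p0]|no] := classic (exists2 p, P p & p <> 0); last first.
  by left=> p hp; apply: NNPP => p0; apply: no; exists p.
right=> q hq; have := add p q hp hq; have := add p 0 hp Q0; have := add 0 q P0 hq.
by lia.
Qed.

(** * The sets [B_n] and [C_n] of the fixed sequence *)

Section FixedSequence.
Variables (n : nat) (a : nat -> nat).
Hypothesis n2 : 2 <= n.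
Hypothesis a_super : superincreasing a n.+1.
Hypothesis a_last : a n.+1 = \sum_(1 <= i < n) a i + 2 * a n.

Let n0 : 0 < n. Proof. exact: ltnW. Qed.
Let sigma := \sum_(1 <= i < n) a i.

Lemma sigma_gap : 2 * sigma < a n.
Proof. by apply: a_super; rewrite n0 /=. Qed.

Lemma a1_gt0 : 0 < a 1.
Proof. by have := a_super (i := 1); rewrite big_geq //; apply. Qed.

Lemma a1_le_sigma : a 1 <= sigma.
Proof. by rewrite /sigma big_ltn // leq_addr. Qed.

(** [a n.+1] is too small for the whole sequence to be superincreasing, so the elements are sorted
    by size. If one is at least [a n.+1], the rest have their sums among those of [a 1, ..., a n].
    Otherwise at most [n - 1] elements are below [a n], and a third element at least [a n] costs one
    of these. *)
Lemma size_le_sumsC (p : seq nat) : all (leq 1) p ->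
  (forall q, subseq q p -> sums a n.+2 (sumn q)) -> size p <= n.+1.
Proof.
move=> pos hp.
have gap := sigma_gap; have s1 := sum_recr a n0.
have s2 := sum_recr a (ltn0Sn n); rewrite -/sigma in s1.
have total := sums_le (hp p (subseq_refl p)).
have a_lastE : a n.+1 = sigma + 2 * a n by exact: a_last.
have [/hasP[x xp ax]|/hasPn small] := boolP (has (leq (a n.+1)) p).
  have sx := sumn_rem xp.
  have [||h _] := @size_le_sums a n.+1 (rem x p) isT a_super.
  - by apply/allP => y /mem_rem; apply/allP.
  - move=> q qs; apply: sums_low => //.
      exact/hp/(subseq_trans qs)/rem_subseq.
    by have := sumn_subseq qs; lia.
  by move: h; rewrite size_rem //; case: (p).
pose big := filter (leq (a n)) p; pose sml := filter (predC (leq (a n))) p.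
have sizeE : size p = size big + size sml by rewrite !size_filter count_predC.
have sumE : sumn p = sumn big + sumn sml.
  by rewrite -sumn_cat; apply/perm_sumn; rewrite perm_sym; exact/permPl/perm_filterC.
have sml_sums q : subseq q sml -> sums a n (sumn q).
  elim: q => [|x q IHq] qs; first exact: sums0.
  have xs : x \in sml by apply: (mem_subseq qs); rewrite mem_head.
  move: (xs); rewrite mem_filter /= -ltnNge => /andP[xn xp].
  have /sums_le lq := IHq (subseq_trans (subseq_cons q x) qs).
  have hx : sums a n.+2 x by have := hp [:: x]; rewrite /= addn0 sub1seq; apply.
  have /sums_le lx : sums a n x by apply: sums_low => //; apply: sums_low => //; lia.
  rewrite /=; apply: sums_low => //; last by lia.
  apply: sums_low => //; last by rewrite -/sigma in lq lx; lia.
  by apply: (hp (x :: q)); exact/(subseq_trans qs)/filter_subseq.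
have [||lt_sml full] := @size_le_sums a n sml n0 (superincreasingW a_super).
- by apply/allP => y; rewrite mem_filter => /andP[_]; apply/allP.
- exact: sml_sums.
have [|big3] := leqP (size big) 2; first lia.
(* Two big elements add up to at least [2 * a n], more than [a 1 + ... + a n], so their sum must use
   [a n.+1]. *)
have pair x y : subseq [:: x; y] big -> a n.+1 <= x + y.
  move=> xy; have hxy : sums a n.+2 (x + y).
    have := hp [:: x; y]; rewrite /= addn0; apply.
    exact/(subseq_trans xy)/filter_subseq.
  have mem z : z \in [:: x; y] -> a n <= z.
    by move/(mem_subseq xy); rewrite mem_filter => /andP[].
  have := mem x; have := mem y; rewrite !inE !eqxx orbT => /(_ isT) ? /(_ isT) ?.
  rewrite leqNgt; apply/negP => lt; have := sums_le (sums_low (ltn0Sn n) hxy lt).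
  by lia.
(* Three big elements weigh at least [3 * a n.+1 / 2]; this leaves at most [sigma / 2] for the small
   ones, which then cannot be [n - 1] in number. Four big elements exceed the total. *)
case: big sizeE sumE big3 pair => [|x [|y [|z [|w r]]]] //= sizeE sumE _ pair.
  have xy := pair x y (mask_subseq [:: true; true] [:: x; y; z]).
  have xz := pair x z (mask_subseq [:: true; false; true] [:: x; y; z]).
  have yz := pair y z (mask_subseq [:: false; true; true] [:: x; y; z]).
  have sg0 : 0 < sigma := leq_trans a1_gt0 a1_le_sigma.
  have [/full|] := eqVneq (size sml) n.-1; rewrite -/sigma; lia.
have xy := pair x y (mask_subseq [:: true; true] [:: x, y, z, w & r]).
have zw := pair z w (mask_subseq [:: false; false; true; true] [:: x, y, z, w & r]).
by lia.
Qed.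

(** The sequence [a 1, ..., a (n-1), a n.+1], with [a n] left out. Its subset sums are the elements
    of [inB] other than [aint a n]. *)
Let a' i := if i == n then a n.+1 else a i.

Lemma a'_sum t : t <= n -> \sum_(1 <= j < t) a' j = \sum_(1 <= j < t) a j.
Proof.
move=> tn; apply: eq_big_nat => j /andP[_ jt].
by rewrite /a' ltn_eqF // (leq_trans jt).
Qed.

Lemma a'_super : superincreasing a' n.+1.
Proof.
move=> i /andP[i0 ilt]; rewrite a'_sum ?(ltnSE ilt) // /a'.
case: eqP => [->|_]; last by apply: a_super; rewrite i0.
by have := sigma_gap; rewrite a_last /sigma; lia.
Qed.

Lemma inB_le b : inB a n b -> b <= sigma + a n.+1.
Proof.
have s1 := sum_recr a n0; have aL : a n.+1 = sigma + 2 * a n := a_last.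
move=> [/sums_le|[->|[c [/sums_le]]]]; rewrite /aint -/sigma; lia.
Qed.

Lemma inB_max : inB a n (sigma + a n.+1).
Proof. by right; right; exists sigma; split=> //; apply: sums_total. Qed.

Lemma inB_sums b : inB a n b -> b <> aint a n -> sums a' n.+1 b.
Proof.
have ext c : inA a n c -> sums a' n c.
  move=> [f ->]; exists f; apply: eq_big_nat => j /andP[_ jn].
  by rewrite /a' ltn_eqF.
have a'n : a' n = a n.+1 by rewrite /a' eqxx.
move=> hb bL; apply/(sums_recr _ _ n0).
case: hb => [/ext|[//|[c [/ext hc ->]]]]; first by left.
by right; exists c; rewrite a'n.
Qed.

(** The extra element [aint a n] stays within [inC] after adding [a n], because [a_last] makes
    [aint a n + a n] equal to [a n.+1]. This is the source of the factorization of length 2. *)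
Lemma inC_decomp c :
  inC a n c <-> exists b e, inB a n b /\ (e = 0 \/ e = a n) /\ c = b + e.
Proof.
have aint_n : aint a n = sigma + a n by rewrite /aint sum_recr.
have aL : a n.+1 = sigma + 2 * a n := a_last.
have C2 := sums_recr a _ (ltn0Sn n); have C1 := sums_recr a _ n0.
split.
  move=> /C2[/C1[h|[x [h ->]]]|[x [/C1[h|[y [h ->]]] ->]]].
  - by exists c, 0; split; [left|rewrite addn0; auto].
  - by exists x, (a n); split; [left|auto].
  - by exists (x + a n.+1), 0; split; [right; right; exists x|rewrite addn0; auto].
  - exists (y + a n.+1), (a n); split; [by right; right; exists y|].
    by split; [right|lia].
have inAC x : inA a n x -> inC a n x by move=> h; apply/C2; left; apply/C1; left.
have inACn x : inA a n x -> inC a n (x + a n).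
  by move=> h; apply/C2; left; apply/C1; right; exists x.
have inACN x : inA a n x -> inC a n (x + a n.+1).
  by move=> h; apply/C2; right; exists x; split=> //; apply/C1; left.
have hsig : inA a n sigma := sums_total a n.
move=> [b [e [[h|[->|[x [h ->]]]] [[->|->] ->]]]]; rewrite ?addn0.
- exact: inAC.
- exact: inACn.
- by rewrite aint_n; apply: inACn.
- have -> : aint a n + a n = 0 + a n.+1 by lia.
  exact/inACN/sums0.
- exact: inACN.
- apply/C2; right; exists (x + a n); split; last by lia.
  by apply/C1; right; exists x.
Qed.

Lemma splits_inB P Q : splits P Q (inB a n) ->
  (forall p, P p -> p = 0) \/ (forall q, Q q -> q = 0).
Proof.
move=> spl; have gap := sigma_gap; have a1s := a1_le_sigma; have a10 := a1_gt0.
have aL : a n.+1 = sigma + 2 * a n := a_last.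
have aint_n : aint a n = sigma + a n by rewrite /aint sum_recr.
(* With [aint a n] in [Q'], both [p] and [p + aint a n] lie in [inB], whose gaps leave only two
   values of [p]. *)
have two P' Q' : splits P' Q' (inB a n) -> Q' (aint a n) ->
    forall p, P' p -> p = 0 \/ p = aint a n.
  move=> [P0 [Q0 [add _]]] QL p hp.
  have := inB_le (add p _ hp QL); have := add p _ hp QL; have := add p 0 hp Q0.
  rewrite addn0 /inB.
  move=> [/sums_le|[|[x [/sums_le hx]]]] hp1 [/sums_le|[|[y [/sums_le hy]]]];
    rewrite -/sigma in hp1 *; rewrite -?/sigma; lia.
have both P' Q' : splits P' Q' (inB a n) -> Q' (aint a n) ->
    (forall p, P' p -> p = 0) \/ (forall q, Q' q -> q = 0).
  move=> sp QL; have twoP := two _ _ sp QL.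
  have [PL|PL] := classic (P' (aint a n)); last first.
    by left=> p hp; case: (twoP p hp) => // e; case: PL; rewrite -e.
  have twoQ := two _ _ (splits_sym sp) PL.
  have [P0 [Q0 [add div]]] := sp.
  (* Sums from [{0, aint a n}] other than 0 exceed [a 1], so distinctness up to [a 1] is clear, yet
     [a 1] is no such sum. *)
  have [||p [q [/twoP hp [/twoQ hq]]]] := div (a 1); last by lia.
  - left; exists (pred1 1); rewrite /subset_sum big_ltn //= big1_seq ?addn0 // => i.
    by rewrite mem_index_iota => /andP[_ /andP[i2 _]]; case: eqP i2 => // ->.
  - move=> p q p' q' /twoP ? /twoQ ? /twoP ? /twoQ ?; lia.
have [QL|QL] := classic (Q (aint a n)); first exact: both spl QL.
have [PL|PL] := classic (P (aint a n)).
  by case: (both _ _ (splits_sym spl) PL); [right|left].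
have [P0 [Q0 [add div]]] := spl.
have hP p : P p -> inB a n p /\ p <> aint a n.
  by move=> hp; split=> [|e]; [rewrite -(addn0 p); apply: add|rewrite e in hp].
have hQ q : Q q -> inB a n q /\ q <> aint a n.
  by move=> hq; split=> [|e]; [apply: (add 0)|rewrite e in hq].
(* Two such elements add up to at most [2 * sigma] or at least [a n.+1], and [aint a n] lies
   strictly between. *)
have far x : inB a n x /\ x <> aint a n -> x <= sigma \/ a n.+1 <= x.
  by move=> [[/sums_le|[|[y [/sums_le]]]]]; rewrite -?/sigma; lia.
have noL p q : P p -> Q q -> p + q <> aint a n.
  by move=> /hP/far ? /hQ/far ?; lia.
have [||p [q [hp [hq e]]]] := div (aint a n); last by case: (noL p q hp hq).
- by right; left.
- move=> p q p' q' hp hq hp' hq' e _.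
  have S x : inB a n x /\ x <> aint a n -> sums a' n.+1 x by case=> *; apply: inB_sums.
  (* The cross sums lie in [inB] and differ from [aint a n], so they too are subset sums of [a']. *)
  apply: (sums_cross a'_super (S p (hP p hp)) (S q (hQ q hq)) (S p' (hP p' hp'))
     (S q' (hQ q' hq'))) => //; apply: S; split; by [apply: add|apply: noL].
Qed.
End FixedSequence.
End SubsetSums.

(** * Multiplication of ideals *)

Section IdealMonoid.
Local Open Scope ring_scope.
Import GRing.Theory.
Variable T : comPzRingType.
Implicit Types (I J A B C : T -> Prop).

Lemma ideq_refl I : ideq I I. Proof. by []. Qed.

Lemma ideq_sym I J : ideq I J -> ideq J I.
Proof. by move=> h x; split=> /h. Qed.

Lemma ideq_trans J I A : ideq I J -> ideq J A -> ideq I A.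
Proof. by move=> h1 h2 x; split=> [/h1/h2|/h2/h1]. Qed.

Lemma imul_mem A B x y : A x -> B y -> imul A B (x * y).
Proof.
move=> ax by_; exists [:: (x, y)]; rewrite big_seq1; split=> // p.
by rewrite inE => /eqP->.
Qed.

Lemma imul0 A B : imul A B 0.
Proof. by exists [::]; rewrite big_nil. Qed.

Lemma imulD A B x y : imul A B x -> imul A B y -> imul A B (x + y).
Proof.
move=> [s [hs ->]] [t [ht ->]]; exists (s ++ t); rewrite big_cat; split=> // p.
by rewrite mem_cat => /orP[/hs|/ht].
Qed.

Lemma imul_min A B J : J 0 -> (forall x y, J x -> J y -> J (x + y)) ->
  (forall x y, A x -> B y -> J (x * y)) -> forall z, imul A B z -> J z.
Proof.
move=> J0 JD JM _ [s [hs ->]]; rewrite big_seq.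
by elim/big_rec: _ => // p x /hs[? ?] ?; apply: JD => //; apply: JM.
Qed.

Lemma imul_ideal A B : is_ideal A -> is_ideal (imul A B).
Proof.
move=> [_ [_ AM]]; split; [exact: imul0|split; [exact: imulD|]] => r.
apply: imul_min => [|x y|x y ax by_].
- by rewrite mulr0; apply: imul0.
- by rewrite mulrDr; apply: imulD.
- by rewrite mulrA; apply: imul_mem => //; apply: AM.
Qed.

Lemma imul_sub A A' B B' : (forall x, A x -> A' x) -> (forall x, B x -> B' x) ->
  forall x, imul A B x -> imul A' B' x.
Proof.
move=> hA hB; apply: imul_min => [||x y /hA ? /hB ?];
  [exact: imul0|exact: imulD|exact: imul_mem].
Qed.

Lemma imul_ideq A A' B B' : ideq A A' -> ideq B B' -> ideq (imul A B) (imul A' B').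
Proof.
by move=> hA hB x; split; apply: imul_sub => z;
  [case: (hA z)|case: (hB z)|case: (hA z)|case: (hB z)].
Qed.

Lemma imulC A B : ideq (imul A B) (imul B A).
Proof.
by move=> x; split; apply: imul_min => [||y z ? ?];
  try (by [exact: imul0|exact: imulD]); rewrite mulrC; apply: imul_mem.
Qed.

Lemma imulA A B C : ideq (imul A (imul B C)) (imul (imul A B) C).
Proof.
move=> x; split.
  apply: imul_min => [||y z hy]; [exact: imul0|exact: imulD|].
  move: z; apply: imul_min => [|z t|z t hz ht].
  - by rewrite mulr0; apply: imul0.
  - by rewrite mulrDr; apply: imulD.
  - by rewrite mulrA; apply/imul_mem/ht/imul_mem.
apply: imul_min => [||y z hy hz]; [exact: imul0|exact: imulD|].
move: y hy; apply: imul_min => [|y t|y t hy ht].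
- by rewrite mul0r; apply: imul0.
- by rewrite mulrDl; apply: imulD.
- by rewrite -mulrA; apply/imul_mem/imul_mem.
Qed.

Lemma imulw A : is_ideal A -> ideq (imul A (@whole T)) A.
Proof.
move=> [A0 [AD AM]] x; split; last by rewrite -{2}(mulr1 x) => ?; apply: imul_mem.
by apply: imul_min => // y z ay _; rewrite mulrC; apply: AM.
Qed.

Lemma iprod_ideal s : (forall i, (i < size s)%N -> is_ideal (nth (@whole T) s i)) ->
  is_ideal (iprod s).
Proof. by case: s => // A s h; apply: imul_ideal; apply: (h 0%N). Qed.

(** Lets results on a product of two ideals be applied to any single factor of a longer product. *)
Lemma iprod_extract s i : (i < size s)%N ->
  ideq (iprod s) (imul (nth (@whole T) s i) (iprod (take i s ++ drop i.+1 s))).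
Proof.
elim: s i => // A s IH [|i] /= hi; first by rewrite drop0.
apply: ideq_trans (imul_ideq (ideq_refl A) (IH i hi)) _.
apply: ideq_trans (imulA _ _ _) _.
apply: ideq_trans (imul_ideq (imulC _ _) (ideq_refl _)) _.
exact/ideq_sym/imulA.
Qed.

Lemma gen_ideal_ideal (P : T -> Prop) : is_ideal (gen_ideal P).
Proof.
split; first by exists [::]; rewrite big_nil.
split=> [x y [s [hs ->]] [t [ht ->]]|r x [s [hs ->]]].
  exists (s ++ t); rewrite big_cat; split=> // p.
  by rewrite mem_cat => /orP[/hs|/ht].
exists [seq (r * p.1, p.2) | p <- s]; split=> [p /mapP[q /hs ? ->] //|].
by rewrite big_map mulr_sumr; apply: eq_bigr => p _; rewrite mulrA.
Qed.

Lemma gen_ideal_mem (P : T -> Prop) x : P x -> gen_ideal P x.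
Proof.
move=> Px; exists [:: (1, x)]; rewrite big_seq1 mul1r; split=> // p.
by rewrite inE => /eqP->.
Qed.

Lemma gen_ideal_min (P J : T -> Prop) : is_ideal J -> (forall x, P x -> J x) ->
  forall x, gen_ideal P x -> J x.
Proof.
move=> [J0 [JD JM]] h _ [s [hs ->]]; rewrite big_seq.
by elim/big_rec: _ => // p x /hs/h ? ?; apply: JD => //; apply: JM.
Qed.

Lemma ideal_sum (J : T -> Prop) (s : seq (T * T)) (f : T * T -> T) :
  is_ideal J -> (forall p, p \in s -> J (f p)) -> J (\sum_(p <- s) f p).
Proof.
by move=> [J0 [JD _]] h; rewrite big_seq; elim/big_rec: _ => // p x /h ? ?; apply: JD.
Qed.

Lemma imul_gen (P Q : T -> Prop) :
  ideq (imul (gen_ideal P) (gen_ideal Q))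
       (gen_ideal (fun z => exists x y, P x /\ Q y /\ z = x * y)).
Proof.
have [gP0 [gPD gPM]] := gen_ideal_ideal (fun z => exists x y, P x /\ Q y /\ z = x * y).
move=> z; split.
  apply: imul_min => // x y hx hy; move: x hx; apply: gen_ideal_min.
    split; first by rewrite mul0r.
    by split=> [u v ? ?|r u ?]; rewrite ?mulrDl -?mulrA; [apply: gPD|apply: gPM].
  move=> x hx; move: y hy; apply: gen_ideal_min.
    split; first by rewrite mulr0.
    by split=> [u v ? ?|r u ?]; rewrite ?mulrDr ?(mulrCA x); [apply: gPD|apply: gPM].
  by move=> y hy; apply: gen_ideal_mem; exists x, y.
apply: gen_ideal_min; first exact/imul_ideal/gen_ideal_ideal.
by move=> _ [x [y [hx [hy ->]]]]; apply: imul_mem; apply: gen_ideal_mem.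
Qed.

Lemma gen_ideal_ext (P Q : T -> Prop) : (forall x, P x <-> Q x) ->
  ideq (gen_ideal P) (gen_ideal Q).
Proof.
move=> h x; split; apply: gen_ideal_min; try exact: gen_ideal_ideal;
  by move=> y hy; apply/gen_ideal_mem/h.
Qed.
End IdealMonoid.

(** * Orders at 0 and echelon bases over a domain *)

Section Orders.
Local Open Scope ring_scope.
Import GRing.Theory.
Variable S : idomainType.
Implicit Types (f g : {poly S}) (V W : {poly S} -> Prop).

Definition has_order f p : Prop := f`_p != 0 /\ forall i, (i < p)%N -> f`_i = 0.

Definition orders V p : Prop := exists f, V f /\ has_order f p.

Definition submodule V : Prop :=
  V 0 /\ (forall f g, V f -> V g -> V (f + g)) /\ forall c f, V f -> V (c *: f).

Lemma coefM_low f g p q i : (forall j, (j < p)%N -> f`_j = 0) ->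
  (forall j, (j < q)%N -> g`_j = 0) -> (i < p + q)%N -> (f * g)`_i = 0.
Proof.
move=> hf hg hi; rewrite coefM big1 // => j _.
have [jp|pj] := ltnP j p; first by rewrite hf ?mul0r.
by rewrite hg ?mulr0 //; have := ltn_ord j; lia.
Qed.

Lemma coefM_order f g p q : (forall j, (j < p)%N -> f`_j = 0) ->
  (forall j, (j < q)%N -> g`_j = 0) -> (f * g)`_(p + q) = f`_p * g`_q.
Proof.
move=> hf hg; rewrite coefM.
have hp : (p < (p + q).+1)%N by rewrite ltnS leq_addr.
rewrite (bigD1 (Ordinal hp)) //= addKn big1 ?addr0 // => j jp.
have [lt|] := ltnP j p; first by rewrite hf ?mul0r.
rewrite leq_eqVlt => /orP[/eqP e|lt].
  by case/eqP: jp; apply: val_inj; exact: esym e.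
by rewrite [g`__]hg ?mulr0 //; have := ltn_ord j; lia.
Qed.

Lemma has_orderM f g p q : has_order f p -> has_order g q -> has_order (f * g) (p + q).
Proof.
move=> [fp hf] [gq hg]; split=> [|i hi]; first by rewrite coefM_order // mulf_neq0.
exact: (coefM_low hf hg).
Qed.

(* [b p] is an element of [V] of order [p] if there is one, and [0] otherwise. *)
Definition echelon V (b : nat -> {poly S}) : Prop :=
  forall p, V (b p) /\ (b p != 0 -> has_order (b p) p) /\ (orders V p -> b p != 0).

Lemma ex_echelon V : submodule V -> exists b, echelon V b.
Proof.
move=> [V0 _].
pose R p f := V f /\ (f != 0 -> has_order f p) /\ (orders V p -> f != 0).
have ex p : exists f, R p f.
  have [[f [Vf fp]]|no] := classic (orders V p).
    exists f; split=> //; split=> // _.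
    by apply: contraNneq (fp.1) => ->; rewrite coef0.
  by exists 0; split=> //; split=> //; rewrite eqxx.
exists (fun p => epsilon (inhabits 0) (R p)) => p.
exact: epsilon_spec (inhabits 0) (R p) (ex p).
Qed.

(** Gaussian elimination on the coefficients below [K]. Over a domain one multiplies by pivots
    instead of dividing, hence the scalar [d]. *)
Lemma echelon_span V b f K : submodule V -> echelon V b -> V f ->
  exists d (c : nat -> S), d != 0 /\
    forall i, (i < K)%N -> (d *: f - \sum_(p < K) c p *: b p)`_i = 0.
Proof.
move=> [V0 [VD VZ]] eb Vf; elim: K => [|K [d [c [d0 hc]]]].
  by exists 1, (fun=> 0); rewrite oner_eq0.
set h := d *: f - _ in hc.
have Vh : V h.
  apply: (VD); first exact: VZ.
  rewrite -scaleN1r; apply: (VZ); apply: (big_ind V) => // p _.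
  by apply: VZ; case: (eb p).
have [hK|hK] := eqVneq h`_K 0.
  exists d, (fun i => if i == K then 0 else c i); split=> // i.
  rewrite big_ord_recr /= eqxx scale0r addr0.
  rewrite (eq_bigr (fun p : 'I_K => c p *: b p)) => [|p _]; last by rewrite ltn_eqF.
  by rewrite ltnS leq_eqVlt => /orP[/eqP->|/hc].
have [_ [bo ob]] := eb K; have /ob/bo[bK0 blow] : orders V K by exists h.
(* The remainder [h] has order [K], so [b K] is a genuine pivot; cross-multiplying by [u] cancels
   the coefficient at [K]. *)
pose u := (b K)`_K.
exists (u * d), (fun i => if i == K then h`_K else u * c i).
split; first by rewrite mulf_neq0.
move=> i; rewrite big_ord_recr /= eqxx.
rewrite (eq_bigr (fun p : 'I_K => u *: (c p *: b p))) => [|p _]; last first.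
  by rewrite ltn_eqF // scalerA.
rewrite -scaler_sumr -scalerA opprD addrA -scalerBr -/h coefB !coefZ.
rewrite ltnS leq_eqVlt => /orP[/eqP->|iK]; first by rewrite mulrC subrr.
by rewrite hc // blow // !mulr0 subr0.
Qed.

(** Both factors of each product are expanded separately; the scalars are then brought to the common
    multiple [d * (d1 * d2)]. *)
Lemma echelon_span_imul V W b b' (s : seq ({poly S} * {poly S})) K :
  submodule V -> submodule W -> echelon V b -> echelon W b' ->
  (forall x, x \in s -> V x.1 /\ W x.2) ->
  exists d (c : nat -> nat -> S), d != 0 /\ forall i, (i < K)%N ->
    (d *: (\sum_(x <- s) x.1 * x.2) -
       \sum_(p < K) \sum_(q < K) c p q *: (b p * b' q))`_i = 0.
Proof.
move=> sV sW eb eb'; elim: s => [_|[f g] s IH hs].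
  exists 1, (fun _ _ => 0); rewrite oner_eq0; split=> // i _.
  rewrite big_nil scaler0 big1 ?subr0 ?coef0 // => p _.
  by rewrite big1 // => q _; rewrite scale0r.
have [|d [c [d0 hc]]] := IH; first by move=> x xs; apply: hs; rewrite inE xs orbT.
have [/= Vf Wg] := hs (f, g) (mem_head _ _).
have [d1 [c1 [d10 hc1]]] := echelon_span K sV eb Vf.
have [d2 [c2 [d20 hc2]]] := echelon_span K sW eb' Wg.
exists (d * (d1 * d2)), (fun p q => d * (c1 p * c2 q) + d1 * d2 * c p q).
split; first by rewrite !mulf_neq0.
move=> i iK; rewrite big_cons /=.
set A := \sum_(p < K) c1 p *: b p in hc1; set B := \sum_(q < K) c2 q *: b' q in hc2.
set X := \sum_(x <- s) _ in hc *; set C := \sum_(p < K) _ in hc.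
have -> : \sum_(p < K) \sum_(q < K)
    (d * (c1 p * c2 q) + d1 * d2 * c p q) *: (b p * b' q)
    = d *: (A * B) + (d1 * d2) *: C.
  rewrite mulr_suml !scaler_sumr -big_split; apply: eq_bigr => p _ /=.
  rewrite mulr_sumr !scaler_sumr -big_split; apply: eq_bigr => q _ /=.
  by rewrite scalerDl -!scalerA -scalerAl -scalerAr.
(* The error is split so that every summand has a factor vanishing below [K]. *)
have -> : (d * (d1 * d2)) *: (f * g + X) - (d *: (A * B) + (d1 * d2) *: C) =
    d *: ((d1 *: f - A) * (d2 *: g) + A * (d2 *: g - B)) + (d1 * d2) *: (d *: X - C).
  by rewrite -!mul_polyC !polyCM; ring.
rewrite coefD !coefZ hc // mulr0 addr0 coefD.
rewrite (@coefM_low _ _ K 0) ?addn0 // (@coefM_low _ _ 0 K) //.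
by rewrite addr0 mulr0.
Qed.

(* The pairs of orders with sum at most [e] have distinct sums, so the products
   of echelon basis elements have distinct orders and cannot cancel. *)
Lemma orders_of_monomial V W e (s : seq ({poly S} * {poly S})) :
  submodule V -> submodule W ->
  (forall x, x \in s -> V x.1 /\ W x.2) -> 'X^e = \sum_(x <- s) x.1 * x.2 ->
  (forall p q p' q', orders V p -> orders W q -> orders V p' -> orders W q' ->
     (p + q = p' + q')%N -> (p + q <= e)%N -> p = p') ->
  exists p q, orders V p /\ orders W q /\ e = (p + q)%N.
Proof.
move=> sV sW hs Xe inj.
have [b eb] := ex_echelon sV; have [b' eb'] := ex_echelon sW.
have [d [c [d0 hc]]] := echelon_span_imul e.+1 sV sW eb eb' hs.
rewrite -Xe in hc.
pose act (x : 'I_e.+1 * 'I_e.+1) := [&& c x.1 x.2 != 0, b x.1 != 0 & b' x.2 != 0].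
pose term (x : 'I_e.+1 * 'I_e.+1) := c x.1 x.2 *: (b x.1 * b' x.2).
have {}hc i : (i <= e)%N -> d * (i == e)%:R = \sum_x (term x)`_i.
  move=> ie; have /eqP := hc i ie; rewrite coefB subr_eq0 coefZ coefXn => /eqP->.
  by rewrite pair_big coef_sum.
have ord_act x : act x -> orders V x.1 /\ orders W x.2 /\ has_order (term x) (x.1 + x.2).
  case/and3P => cx bx b'x; have [Vb [/(_ bx) ob _]] := eb x.1.
  have [Wb [/(_ b'x) ob' _]] := eb' x.2.
  split; first by exists (b x.1).
  split; first by exists (b' x.2).
  have [h1 h2] := has_orderM ob ob'.
  by split=> [|i /h2 hi]; rewrite coefZ ?mulf_neq0 // hi mulr0.
have no_act x i : ~~ act x -> (term x)`_i = 0.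
  rewrite /act /term !negb_and !negbK => /or3P[] /eqP->.
  - by rewrite scale0r coef0.
  - by rewrite mul0r scaler0 coef0.
  - by rewrite mulr0 scaler0 coef0.
have [x0 ax0] : exists x, act x.
  apply: NNPP => no; have := hc e (leqnn e); rewrite eqxx mulr1 big1.
    by move/eqP; rewrite (negPf d0).
  by move=> x _; apply: no_act; apply/negP => ax; apply: no; exists x.
(* If the least sum of an active pair exceeded [e], the coefficient [d] at [e] would vanish.
   Otherwise [inj] leaves a single active pair with this sum, so its lowest coefficient survives,
   and the left side has one only at [e]. *)
case: (arg_minnP (fun x : 'I_e.+1 * 'I_e.+1 => (x.1 + x.2)%N) ax0) => x ax xmin.
have [ox1 [ox2 [ox lowx]]] := ord_act x ax.
exists x.1, x.2; split=> //; split=> //; apply/eqP.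
have zero y i : (i < x.1 + x.2)%N -> (term y)`_i = 0.
  move=> hi; have [ay|] := boolP (act y); last exact: no_act.
  by have [_ [_ [_]]] := ord_act y ay; apply; apply: leq_trans hi (xmin _ ay).
have [le|lt] := leqP (x.1 + x.2) e; last first.
  have := hc e (leqnn e); rewrite eqxx mulr1 big1 => [/eqP|y _]; last exact: zero.
  by rewrite (negPf d0).
have := hc _ le; rewrite (bigD1 x) //= big1 ?addr0 => [|y yx].
  rewrite eq_sym; case: eqP => // _ /eqP; rewrite mulr0 eq_sym.
  by rewrite (negPf ox).
have [ay|] := boolP (act y); last exact: no_act.
have [oy1 [oy2 [_ lowy]]] := ord_act y ay.
apply: lowy; rewrite ltn_neqAle xmin // andbT; apply: contraNneq yx => e12.
have e1 := inj _ _ _ _ ox1 ox2 oy1 oy2 e12 le.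
rewrite -pair_eqE /pair_eq /= -!val_eqE /=.
by move: e12; rewrite e1 => /addnI ->; rewrite !eqxx.
Qed.
End Orders.

(** * Lowest homogeneous parts in [x] and [y] *)

Section LowestSlices.
Local Open Scope ring_scope.
Import GRing.Theory.
Variables (R : comNzRingType) (S : idomainType).
Variables (phi : {rmorphism R -> {poly {poly S}}}) (psi : {rmorphism S -> R}).
Variables (x y : R).
(* [phi] is [x |-> T], [y |-> Y T], so the coefficient of [T ^ d] in [phi f] is
   the part of degree [d] of [f] in [x] and [y], dehomogenized to a polynomial
   in [Y]. *)
Hypothesis phi_psi : forall c, phi (psi c) = c%:P%:P.
Hypothesis phi_x : phi x = 'X.
Hypothesis phi_y : phi y = 'X%:P * 'X.
Hypothesis phi_size : forall f d, (size ((phi f)`_d)%R <= d.+1)%N.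
Hypothesis mod_xy : forall f, exists u v, f = psi (phi f)`_0`_0 + u * x + v * y.

Implicit Types (A B : R -> Prop) (P Q : nat -> Prop).

Definition has_degree A r : Prop :=
  (forall f i, A f -> (i < r)%N -> (phi f)`_i = 0) /\ exists f, A f /\ (phi f)`_r != 0.

Definition slice A r : {poly S} -> Prop := fun v => exists f, A f /\ v = (phi f)`_r.

(** The set [P A]. Quantifying over [r] avoids choosing the degree, which [has_degree_inj] shows to
    be unique. *)
Definition low_orders A p : Prop := exists r, has_degree A r /\ orders (slice A r) p.

Definition monomials P m : R -> Prop :=
  gen_ideal (fun g => exists b, P b /\ g = x ^+ (m - b) * y ^+ b).

Lemma has_degree_inj A r s : has_degree A r -> has_degree A s -> r = s.
Proof.
move=> [lr [f [Af fr]]] [ls [g [Ag gs]]]; case: (ltngtP r s) => // lt.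
  by case/eqP: fr; apply: ls.
by case/eqP: gs; apply: lr.
Qed.

Lemma has_degree_ideq A B r : ideq A B -> has_degree A r -> has_degree B r.
Proof.
move=> AB [l [f [Af fr]]]; split=> [g i /AB|]; first exact: l.
by exists f; split=> //; apply/AB.
Qed.

Lemma low_orders_ideq A B p : ideq A B -> low_orders A p -> low_orders B p.
Proof.
move=> AB [r [hr [v [[f [Af fv]] vp]]]]; exists r; split.
  exact: has_degree_ideq hr.
by exists v; split=> //; exists f; split=> //; apply/AB.
Qed.

Lemma low_ordersE A r p : has_degree A r -> low_orders A p -> orders (slice A r) p.
Proof. by move=> hr [s [hs]]; rewrite (has_degree_inj hr hs). Qed.

Lemma slice_submodule A r : is_ideal A -> submodule (slice A r).
Proof.
move=> [A0 [AD AM]]; split; first by exists 0; rewrite rmorph0 coef0.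
split=> [_ _ [f [Af ->]] [g [Ag ->]]|c _ [f [Af ->]]].
  by exists (f + g); rewrite rmorphD coefD; split=> //; apply: AD.
exists (psi c * f); split; first exact: AM.
by rewrite rmorphM /= phi_psi coefCM mul_polyC.
Qed.

Lemma phiM_degree A B r s f g : has_degree A r -> has_degree B s -> A f -> B g ->
  (phi (f * g))`_(r + s) = (phi f)`_r * (phi g)`_s.
Proof.
move=> [lr _] [ls _] Af Bg; rewrite rmorphM coefM_order // => i ilt; first exact: lr.
exact: ls.
Qed.

Lemma has_degree_imul A B r s : has_degree A r -> has_degree B s ->
  has_degree (imul A B) (r + s).
Proof.
move=> hr hs; split=> [h i hh ilt|].
  move: h hh; apply: imul_min => [|f g hf hg|f g Af Bg].
  - by rewrite rmorph0 coef0.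
  - by rewrite rmorphD coefD hf hg addr0.
  - rewrite rmorphM; apply: coefM_low ilt => j; [exact: hr.1|exact: hs.1].
have [[_ [f [Af f0]]] [_ [g [Bg g0]]]] := (hr, hs).
exists (f * g); split; first exact: imul_mem.
by rewrite (phiM_degree hr hs) // mulf_neq0.
Qed.

Lemma ex_has_degree A f : A f -> phi f != 0 -> exists r, has_degree A r.
Proof.
move=> Af f0.
have [d [[g [Ag gd]] dmin]] : exists d, (exists g, A g /\ (phi g)`_d != 0) /\
    forall g i, A g -> (i < d)%N -> (phi g)`_i = 0.
  have [d] : exists d, (exists g, A g /\ (phi g)`_d != 0).
    by exists (size (phi f)).-1, f; rewrite -lead_coefE lead_coef_eq0.
  elim/ltn_ind: d => d IH ex.
  have [[i [id exi]]|no] := classic (exists i, (i < d)%N /\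
      exists g, A g /\ (phi g)`_i != 0); first exact: (IH i id exi).
  exists d; split=> // g i Ag id; apply/eqP/negP => /negP gi.
  by apply: no; exists i; split=> //; exists g.
by exists d; split; [|exists g].
Qed.

Lemma has_degree_factors A B f : imul A B f -> phi f != 0 ->
  exists r s, has_degree A r /\ has_degree B s.
Proof.
move=> ABf f0; suff [[g [Ag g0]] [h [Bh h0]]] :
    (exists g, A g /\ phi g != 0) /\ exists h, B h /\ phi h != 0.
  have [r hr] := ex_has_degree Ag g0; have [s hs] := ex_has_degree Bh h0.
  by exists r, s.
apply: NNPP => no; case/eqP: f0; move: f ABf.
apply: imul_min => [|f g hf hg|f g Af Bg]; first by rewrite rmorph0.
  by rewrite rmorphD hf hg addr0.
apply/eqP; rewrite rmorphM mulf_eq0; apply/norP => -[f0 g0]; apply: no.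
by split; [exists f|exists g].
Qed.

(** As [A] and [B] start in degrees [r] and [s], only products of lowest parts reach degree
    [r + s]. *)
Lemma slice_imul A B r s v : has_degree A r -> has_degree B s ->
  slice (imul A B) (r + s) v ->
  exists l : seq ({poly S} * {poly S}),
    (forall z, z \in l -> slice A r z.1 /\ slice B s z.2) /\
    v = \sum_(z <- l) z.1 * z.2.
Proof.
move=> hr hs [_ [[l [hl ->]] ->]].
exists [seq ((phi z.1)`_r, (phi z.2)`_s) | z <- l]; split.
  by move=> _ /mapP[z /hl[Az Bz] ->]; split; [exists z.1|exists z.2].
rewrite rmorph_sum coef_sum big_map !big_seq; apply: eq_bigr => z /hl[Az Bz].
exact: (phiM_degree hr hs).
Qed.

Lemma low_orders_imul A B p q : low_orders A p -> low_orders B q ->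
  low_orders (imul A B) (p + q).
Proof.
move=> [r [hr [_ [[f [Af ->]] fp]]]] [s [hs [_ [[g [Bg ->]] gq]]]].
exists (r + s)%N; split; first exact: has_degree_imul.
exists ((phi f)`_r * (phi g)`_s); split; last exact: has_orderM.
by exists (f * g); split; [exact: imul_mem|rewrite (phiM_degree hr hs)].
Qed.

(** * Monomial ideals and their factors *)

Section Monomials.
Variables (P : nat -> Prop) (m : nat).
Hypothesis P_le : forall b, P b -> (b <= m)%N.

Lemma phi_monomial b : P b -> phi (x ^+ (m - b) * y ^+ b) = ('X^b)%:P * 'X^m.
Proof.
move=> /P_le bm; rewrite rmorphM !rmorphXn /= phi_x phi_y exprMn mulrCA.
by rewrite -exprD subnK // polyC_exp.
Qed.

Lemma monomials_mem b : P b -> monomials P m (x ^+ (m - b) * y ^+ b).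
Proof. by move=> Pb; apply: gen_ideal_mem; exists b. Qed.

Lemma slice_monomials b : P b -> slice (monomials P m) m 'X^b.
Proof.
move=> Pb; exists (x ^+ (m - b) * y ^+ b); split; first exact: monomials_mem.
by rewrite phi_monomial // coefCM coefXn eqxx mulr1.
Qed.

(** In degree [m] a multiple [r * f] sees only the degree 0 part of [r], which is constant in [Y] by
    [phi_size]; so no new exponent appears. *)
Lemma monomials_coef f : monomials P m f ->
  (forall i, (i < m)%N -> (phi f)`_i = 0) /\ forall i, ((phi f)`_m)`_i != 0 -> P i.
Proof.
move: f; apply: gen_ideal_min => [|_ [b [Pb ->]]]; last first.
  rewrite phi_monomial //; split=> i.
    by rewrite coefCM coefXn => /ltn_eqF->; rewrite mulr0.
  by rewrite coefCM !coefXn eqxx mulr1 coefXn; case: (i =P b) => [-> //|_]; rewrite eqxx.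
split; first by rewrite rmorph0; split=> i; rewrite !coef0 ?eqxx.
split=> [f g [f1 f2] [g1 g2]|r f [f1 f2]].
  rewrite rmorphD; split=> i; first by move=> im; rewrite coefD f1 // g1 // addr0.
  rewrite !coefD => fg0; have [f0|] := eqVneq (phi f)`_m`_i 0; last exact: f2.
  by apply: g2; move: fg0; rewrite f0 add0r.
rewrite rmorphM; split=> i; first by move=> im; apply: (@coefM_low _ _ _ 0 m).
rewrite -{1}(add0n m) (@coefM_order _ _ _ 0 m) //.
rewrite [(phi r)`_0]size1_polyC ?phi_size // coefCM mulf_eq0 negb_or.
by case/andP => _; apply: f2.
Qed.

Lemma has_degree_monomials b : P b -> has_degree (monomials P m) m.
Proof.
move=> Pb; split=> [f i /monomials_coef[h _]|]; first exact: h.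
have [f [If fb]] := slice_monomials Pb; exists f; split=> //.
by rewrite -fb monic_neq0 ?monicXn.
Qed.

Lemma low_orders_monomials c b : P c -> low_orders (monomials P m) b <-> P b.
Proof.
move=> Pc; split=> [[r [hr [_ [[f [If ->]] [fb _]]]]]|Pb].
  move: fb; rewrite (has_degree_inj hr (has_degree_monomials Pc)).
  exact: (monomials_coef If).2.
exists m; split; first exact: has_degree_monomials Pb.
exists 'X^b; split; first exact: slice_monomials.
by split=> [|i ib]; rewrite coefXn ?eqxx ?oner_neq0 // ltn_eqF.
Qed.

Lemma monomials_nonzero b : P b -> nonzero_ideal (monomials P m).
Proof.
move=> Pb; have [_ [f [If f0]]] := has_degree_monomials Pb; exists f; split=> //.
by apply: contraNneq f0 => ->; rewrite rmorph0 coef0.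
Qed.

Lemma monomials_proper b : P b -> (0 < m)%N -> ~ ideq (monomials P m) (@whole R).
Proof.
move=> Pb m0 h; have := (has_degree_monomials Pb).1 1 0%N _ m0.
by rewrite rmorph1 coef1 => /(_ ((h 1).2 I))/eqP; rewrite oner_eq0.
Qed.

(* If [A] has degree [0] it contains [1 + u x + v y]; as it also contains
   [x ^ m] and [y ^ m], it is the whole ring. *)
Lemma degree0_whole A B : is_ideal A -> ideq (monomials P m) (imul A B) ->
  P 0%N -> P m -> has_degree A 0 -> has_degree B m -> ideq A (@whole R).
Proof.
move=> idA IAB P0 Pm hA hB; have [A0 [AD AM]] := idA.
have sub f : monomials P m f -> A f.
  by move/IAB; move: f; apply: imul_min => // f g Af _; rewrite mulrC; apply: AM.
have Ax : A (x ^+ m).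
  by have := sub _ (monomials_mem P0); rewrite subn0 expr0 mulr1.
have Ay : A (y ^+ m).
  by have := sub _ (monomials_mem Pm); rewrite subnn expr0 mul1r.
(* Write [x ^+ m] as a sum of products [z.1 * z.2] and compare order 0 in degree [m]: weighting each
   [z.1] by that coefficient of [z.2] gives an element of [A] with constant term 1. *)
have [f [Af [u [v f_eq]]]] : exists f, A f /\ exists u v, f = 1 + u * x + v * y.
  have [l [hl]] : imul A B (x ^+ (m - 0) * y ^+ 0) by apply/IAB/monomials_mem.
  move/(congr1 (fun h => (phi h)`_m`_0)); rewrite phi_monomial // coefCM coefXn eqxx.
  rewrite mulr1 coefXn eqxx rmorph_sum !coef_sum => one.
  pose F := \sum_(z <- l) psi (phi z.2)`_m`_0 * z.1.
  have [u [v]] := mod_xy F; suff -> : (phi F)`_0`_0 = 1.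
    rewrite rmorph1 => F_eq; exists F; split; last by exists u, v.
    by apply: ideal_sum => // z /hl[Az _]; apply: AM.
  apply: etrans (esym one); rewrite rmorph_sum !coef_sum !big_seq.
  apply: eq_bigr => z /hl[Az Bz].
  rewrite rmorphM /= phi_psi coefCM coefCM -{2}(add0n m) (phiM_degree hA hB) //.
  by rewrite coef0M mulrC.
(* From degree [2 * m] on, a monomial is divisible by [x ^+ m] or [y ^+ m]. Below, multiplying it by
   [f] rewrites it modulo [A] through monomials of one degree more, and so down to 1. *)
have nilp k i j : (2 * m <= i + j + k)%N -> A (x ^+ i * y ^+ j).
  elim: k i j => [|k IH] i j le.
    have [mi|im] := leqP m i.
      by rewrite -(subnK mi) exprD mulrAC; apply: AM.
    by rewrite -(@subnK m j) 1?exprD 1?mulrA; [apply: AM|lia].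
  have -> : x ^+ i * y ^+ j = (x ^+ i * y ^+ j) * f +
      ((- u) * (x ^+ i.+1 * y ^+ j) + (- v) * (x ^+ i * y ^+ j.+1)).
    by rewrite f_eq !exprS; ring.
  by apply: (AD); [exact: AM|apply: (AD); apply: AM; apply: IH; lia].
move=> g; split=> // _; have := AM g _ (nilp (2 * m)%N 0%N 0%N (leqnn _)).
by rewrite !expr0 !mulr1.
Qed.

Lemma factor_splits A B : is_ideal A -> is_ideal B -> P 0%N -> P m ->
  ideq (monomials P m) (imul A B) -> splits (low_orders A) (low_orders B) P.
Proof.
move=> idA idB P0 Pm IAB.
have degI := has_degree_monomials P0.
have [f [/IAB ABf f0]] := degI.2.
have [r [s [hr hs]]] : exists r s, has_degree A r /\ has_degree B s.
  by apply: has_degree_factors ABf _; apply: contraNneq f0 => ->; rewrite coef0.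
have rsm := has_degree_inj (has_degree_imul hr hs) (has_degree_ideq IAB degI).
have add p q : low_orders A p -> low_orders B q -> P (p + q)%N.
  move=> hp hq; apply/(low_orders_monomials _ P0).
  by apply/low_orders_ideq/low_orders_imul/hq/hp/ideq_sym.
have div e : P e -> (forall p q p' q', low_orders A p -> low_orders B q ->
    low_orders A p' -> low_orders B q' -> (p + q = p' + q')%N -> (p + q <= e)%N -> p = p') ->
    exists p q, low_orders A p /\ low_orders B q /\ e = (p + q)%N.
  move=> Pe inj; have [g [Ig gX]] := slice_monomials Pe.
  have [|l [hl Xe]] := @slice_imul A B r s 'X^e hr hs.
    by exists g; split; [apply/IAB|rewrite rsm].
  have sA := slice_submodule r idA; have sB := slice_submodule s idB.
  have [|p [q [hp [hq ->]]]] := orders_of_monomial sA sB hl Xe.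
    move=> p q p' q' hp hq hp' hq'.
    by apply: inj; [exists r|exists s|exists r|exists s].
  by exists p, q; split; [exists r|split; [exists s|]].
(* At [e = 0] distinctness is trivial, which puts 0 in both sets of orders. *)
have [p [q [hp [hq e0]]]] : exists p q, low_orders A p /\ low_orders B q /\ 0%N = (p + q)%N.
  by apply: div => // p q p' q' *; lia.
have [p0 q0] : p = 0%N /\ q = 0%N by lia.
by split; [rewrite -p0|split; [rewrite -q0|]].
Qed.

(** Splitting [e = m] makes [m] an order of [B], so the degree of [B] is at least [m]. As the two
    degrees add up to [m], [A] has degree 0. *)
Lemma order0_whole A B : is_ideal A -> is_ideal B -> P 0%N -> P m ->
  ideq (monomials P m) (imul A B) -> (forall p, low_orders A p -> p = 0%N) ->
  ideq A (@whole R).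
Proof.
move=> idA idB P0 Pm IAB only0.
have [_ [_ [_ div]]] := factor_splits idA idB P0 Pm IAB.
have [|p [q [/only0-> [hq mq]]]] := div m Pm.
  by move=> p q p' q' /only0-> _ /only0->.
have [_ [s [hs _]]] := (tt, hq).
have degI := has_degree_monomials P0.
have [r hr] : exists r, has_degree A r.
  have [f [/IAB ABf f0]] := degI.2.
  have [|r [_ [hr _]]] := has_degree_factors ABf; last by exists r.
  by apply: contraNneq f0 => ->; rewrite coef0.
have rsm := has_degree_inj (has_degree_imul hr hs) (has_degree_ideq IAB degI).
(* Lowest parts of degree [s] have degree at most [s] in [Y], so no order exceeds [s]. *)
have qs : (q <= s)%N.
  have [v [[f [_ ->]] [fq _]]] := low_ordersE hs hq.
  rewrite leqNgt; apply: contra fq => sq; apply/eqP/nth_default.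
  exact: leq_trans (phi_size f s) sq.
have [r0 sm] : r = 0%N /\ s = m by lia.
by apply: (degree0_whole idA IAB P0 Pm); rewrite -?sm -?r0.
Qed.

Lemma monomials_atom : (0 < m)%N -> P 0%N -> P m ->
  (forall L L', splits L L' P ->
     (forall p, L p -> p = 0%N) \/ (forall q, L' q -> q = 0%N)) ->
  is_atom (monomials P m).
Proof.
move=> m0 P0 Pm split_P; split.
  by split; [exact: gen_ideal_ideal|exact: monomials_nonzero P0].
split; first exact: monomials_proper P0 m0.
move=> A B [idA _] [idB _] IAB.
case: (split_P _ _ (factor_splits idA idB P0 Pm IAB)) => only0; [left|right].
  exact: (order0_whole idA idB P0 Pm IAB only0).
apply: (order0_whole idB idA P0 Pm _ only0).
exact: ideq_trans IAB (imulC A B).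
Qed.
End Monomials.

Lemma monomialsM P Q P' m m' :
  (forall b, P b -> (b <= m)%N) -> (forall b, Q b -> (b <= m')%N) ->
  (forall c, P' c <-> exists b e, P b /\ Q e /\ c = (b + e)%N) ->
  ideq (monomials P' (m + m')) (imul (monomials P m) (monomials Q m')).
Proof.
move=> Pm Qm hP'; apply: ideq_sym; apply: ideq_trans (imul_gen _ _) _.
apply: gen_ideal_ext => z.
have mulE b e : P b -> Q e -> x ^+ (m - b) * y ^+ b * (x ^+ (m' - e) * y ^+ e) =
    x ^+ (m + m' - (b + e)) * y ^+ (b + e).
  move=> /Pm bm /Qm em; rewrite mulrACA -!exprD; congr (x ^+ _ * _).
  lia.
split.
  move=> [_ [_ [[b [Pb ->]] [[e [Qe ->]] ->]]]]; exists (b + e)%N.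
  by split; [apply/hP'; exists b, e|exact: mulE].
move=> [_ [/hP'[b [e [Pb [Qe ->]]]] ->]]; rewrite -mulE //.
by exists (x ^+ (m - b) * y ^+ b), (x ^+ (m' - e) * y ^+ e);
  split; [exists b|split; [exists e|]].
Qed.

Lemma monomials_ext P Q m : (forall b, P b <-> Q b) ->
  ideq (monomials P m) (monomials Q m).
Proof.
by move=> PQ; apply: gen_ideal_ext => z; split=> -[b [/PQ ? ->]]; exists b.
Qed.

Lemma monomials0 : ideq (monomials (fun b => b = 0%N) 0) (@whole R).
Proof.
move=> f; split=> // _; have [_ [_ IM]] := gen_ideal_ideal
  (fun g => exists b, b = 0%N /\ g = x ^+ (0 - b) * y ^+ b).
have := IM f 1; rewrite mulr1; apply; apply: gen_ideal_mem.
by exists 0%N; rewrite !expr0 mulr1.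
Qed.

Lemma monomials_pair_atom c : (0 < c)%N -> is_atom (monomials (fun b => b = 0%N \/ b = c) c).
Proof.
move=> c0; apply: monomials_atom => //; [by move=> b [->|->]|by left|by right|].
by move=> L L'; apply: splits_pair.
Qed.

(** Each factor contributes either the order 0 or its chosen order, and orders add under
    products. *)
Lemma low_orders_iprod (s : seq (R -> Prop)) (p : seq nat) : size s = size p ->
  (forall i, (i < size s)%N -> low_orders (nth (@whole R) s i) 0 /\
     low_orders (nth (@whole R) s i) (nth 0%N p i)) ->
  forall q, subseq q p -> low_orders (iprod s) (sumn q).
Proof.
elim: s p => [|A s IH] [|x0 p] // => [_ _ q|[sp] h q].
  rewrite subseq0 => /eqP->; apply: low_orders_ideq monomials0 _.
  by apply/(@low_orders_monomials _ 0 _ 0) => // b ->.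
have [A0 Ax] := h 0%N isT.
have {}IH := IH p sp (fun i => h i.+1).
case: q => [_|z q] /=; first by apply/(low_orders_imul A0)/(IH [::])/sub0seq.
case: eqP => [->|_] /IH hq; first exact: low_orders_imul.
by rewrite -[(z + _)%N]add0n; apply: low_orders_imul.
Qed.

(** * Factorization lengths of the ideal of [C_n] *)

Section Lengths.
Variables (n : nat) (a : nat -> nat).
Hypothesis n2 : (2 <= n)%N.
Hypothesis a_super : superincreasing a n.+1.
Hypothesis a_last : (a n.+1 = \sum_(1 <= i < n) a i + 2 * a n)%N.

Let a_gt0 i : (1 <= i <= n.+1)%N -> (0 < a i)%N.
Proof.
case/andP=> i1; rewrite leq_eqVlt => /orP[/eqP->|ilt].
  by have := sigma_gap n2 a_super; lia.
by apply: leq_ltn_trans (a_super _); rewrite ?i1.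
Qed.

Let mu := aint a n.+1.
Let mB := (\sum_(1 <= i < n) a i + a n.+1)%N.

Lemma mu_eq : mu = (mB + a n)%N.
Proof. by rewrite /mu /aint !sum_recr // ?(ltnW n2) // /mB; lia. Qed.

Lemma monomials_inB_atom : is_atom (monomials (inB a n) mB).
Proof.
apply: monomials_atom.
- exact: inB_le.
- by rewrite /mB addn_gt0 (a_gt0 (i := n.+1)) ?orbT //= leqnn.
- by left; apply: sums0.
- exact: inB_max.
- exact: splits_inB.
Qed.

Lemma monomials_inC_eq :
  ideq (monomials (inC a n) mu)
       (imul (monomials (inB a n) mB) (monomials (fun b => b = 0%N \/ b = a n) (a n))).
Proof.
rewrite mu_eq; apply: monomialsM; first exact: inB_le.
  by move=> b [->|->].
exact: inC_decomp.
Qed.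

Lemma in_lengths_2 : in_lengths (monomials (inC a n) mu) 2.
Proof.
exists [:: monomials (inB a n) mB; monomials (fun b => b = 0%N \/ b = a n) (a n)].
split=> //; split.
  move=> [|[|//]] _; first exact: monomials_inB_atom.
  by apply/monomials_pair_atom/a_gt0; lia.
apply: ideq_trans monomials_inC_eq _.
exact/imul_ideq/ideq_sym/imulw/gen_ideal_ideal.
Qed.

(** Choosing [x ^+ a i] or [y ^+ a i] in each factor amounts to choosing a set of indices. The list
    is reversed so that the last index is the outermost factor of [iprod]. *)
Lemma iprod_pairs t :
  ideq (iprod [seq monomials (fun b => b = 0%N \/ b = a i) (a i) | i <- rev (iota 1 t)])
       (monomials (sums a t.+1) (\sum_(1 <= j < t.+1) a j)).
Proof.
elim: t => [|t IH].
  rewrite big_geq //; apply: ideq_trans (ideq_sym monomials0) _.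
  apply: monomials_ext => b; split=> [->|/sums_le]; first exact: sums0.
  by rewrite big_geq // leqn0 => /eqP.
rewrite -(addn1 t) iotaD rev_cat map_cat /= add1n addn1.
apply: ideq_trans (imul_ideq (ideq_refl _) IH) _.
apply: ideq_trans (imulC _ _) _; apply: ideq_sym.
rewrite (sum_recr a (t := t.+1)) //; apply: monomialsM.
- exact: sums_le.
- by move=> b [->|->].
move=> c; split=> [/sums_recr-/(_ isT)[h|[c' [h ->]]]|[b [e [h [[->|->] ->]]]]].
- by exists c, 0%N; rewrite addn0; split; [|split; [left|]].
- by exists c', (a t.+1); split; [|split; [right|]].
- by apply/sums_recr => //; left; rewrite addn0.
- by apply/sums_recr => //; right; exists b.
Qed.

Lemma in_lengths_Sn : in_lengths (monomials (inC a n) mu) n.+1.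
Proof.
exists [seq monomials (fun b => b = 0%N \/ b = a i) (a i) | i <- rev (iota 1 n.+1)].
rewrite size_map size_rev size_iota; split=> //; split; last exact/ideq_sym/iprod_pairs.
move=> i ilt; rewrite (nth_map 0%N) ?size_rev ?size_iota //.
apply/monomials_pair_atom/a_gt0.
rewrite nth_rev size_iota // nth_iota; lia.
Qed.

Lemma in_lengths_bounds k : in_lengths (monomials (inC a n) mu) k -> (2 <= k <= n.+1)%N.
Proof.
move=> [s [<- [atoms ICs]]].
have C_le c : inC a n c -> (c <= mu)%N by apply: sums_le.
have C0 : inC a n 0%N by apply: sums0.
have Cmu : inC a n mu by apply: sums_total.
have mu0 : (0 < mu)%N.
  by rewrite mu_eq /mB; have := a_gt0 (i := n.+1); rewrite leqnn => /(_ isT); lia.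
have an0 : (0 < a n)%N by apply: a_gt0; lia.
apply/andP; split.
  (* Length 0 would give the whole ring; length 1 would make an atom of a product of two proper
     ideals. *)
  case: s atoms ICs => [|A [|? ?]] //= atoms ICs.
    by case: (monomials_proper C_le C0 mu0).
  have [[idA _] [_ irrA]] := atoms 0%N isT.
  have eqA := ideq_trans (ideq_sym (ideq_trans ICs (imulw idA))) monomials_inC_eq.
  have [irB [propB _]] := monomials_inB_atom.
  have [irP [propP _]] := monomials_pair_atom an0.
  by case: (irrA _ _ irB irP eqA).
pose D i p := low_orders (nth (@whole R) s i) p /\ (0 < p)%N.
have factor i : (i < size s)%N -> low_orders (nth (@whole R) s i) 0 /\ exists p, D i p.
  move=> ilt; have [[idA _] [propA _]] := atoms i ilt.
  set B := iprod (take i s ++ drop i.+1 s).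
  have idB : is_ideal B.
    apply: iprod_ideal => j; rewrite size_cat size_take ilt size_drop => jlt.
    rewrite nth_cat size_take ilt; have [ji|ij] := ltnP j i.
      by rewrite nth_take //; case: (atoms j (ltn_trans ji ilt)) => -[].
    by rewrite nth_drop; apply: (atoms (i.+1 + (j - i))%N _).1.1; lia.
  have IAB := ideq_trans ICs (iprod_extract ilt).
  split; first by have [] := factor_splits C_le idA idB C0 Cmu IAB.
  (* A factor without a positive order would be the whole ring. *)
  apply: NNPP => no; apply/propA/(order0_whole C_le idA idB C0 Cmu IAB) => p hp.
  by case: p hp => // p hp; case: no; exists p.+1.
pose p := mkseq (fun i => epsilon (inhabits 0%N) (D i)) (size s).
have pD i : (i < size s)%N -> D i (nth 0%N p i).
  move=> ilt; rewrite nth_mkseq //; apply: epsilon_spec; exact: (factor i ilt).2.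
rewrite -[size s](size_mkseq (fun i => epsilon (inhabits 0%N) (D i))).
apply: (size_le_sumsC n2 a_super a_last).
  by apply/(all_nthP 0%N) => i; rewrite size_mkseq => /pD[].
move=> q qp; apply/(low_orders_monomials C_le _ C0).
apply: low_orders_ideq (ideq_sym ICs) _.
apply: low_orders_iprod qp; first by rewrite size_mkseq.
by move=> i ilt; split; [exact: (factor i ilt).1|exact: (pD i ilt).1].
Qed.

Lemma atom_and_lengths :
  is_atom (monomials (inB a n) mB) /\
  (in_lengths (monomials (inC a n) mu) 2 /\ in_lengths (monomials (inC a n) mu) n.+1 /\
   forall k, in_lengths (monomials (inC a n) mu) k -> (2 <= k <= n.+1)%N).
Proof.
split; first exact: monomials_inB_atom.
split; first exact: in_lengths_2.
by split; [exact: in_lengths_Sn|exact: in_lengths_bounds].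
Qed.
End Lengths.
End LowestSlices.

(** * The substitution [X |-> T], [Y |-> Y T] on multivariate polynomials *)

Section Dehomogenization.
Local Open Scope ring_scope.
Import GRing.Theory.

Lemma mpoly_ring_ind n (D : comNzRingType) (K : {mpoly D[n]} -> Prop) :
  (forall c, K c%:MP) -> (forall i, K 'X_i) ->
  (forall f g, K f -> K g -> K (f + g)) -> (forall f g, K f -> K g -> K (f * g)) ->
  forall f, K f.
Proof.
move=> KC KX KD KM; apply: mpolyind => [|c m f _ _ Kf]; first exact: (KC 0).
apply: KD => //; rewrite -mul_mpolyC; apply: (KM) => //.
rewrite mpolyXE_id; apply: big_ind => [|//|i _]; first exact: (KC 1).
elim: (m i) => [|k IH]; first exact: (KC 1).
by rewrite exprS; apply: KM.
Qed.

Variables (D : idomainType) (N : nat).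
Let R := {mpoly D[N.+2]}.
Let S := {mpoly D[N]}.

(** [S] carries the variables other than [X] and [Y]; [psi] embeds it, and [phi] treats these
    variables as constants. *)
Lemma ex_dehomogenization : exists (phi : {rmorphism R -> {poly {poly S}}})
    (psi : {rmorphism S -> R}),
  ((forall c, phi c%:MP = c%:MP%:P%:P) /\
   (phi 'X_ord0 = 'X) /\ (phi 'X_(lift ord0 ord0) = 'X%:P * 'X) /\
   (forall k : 'I_N, phi 'X_(lift ord0 (lift ord0 k)) = ('X_k : S)%:P%:P)) /\
  (forall c, psi c%:MP = c%:MP) /\
  (forall k : 'I_N, psi 'X_k = 'X_(lift ord0 (lift ord0 k))).
Proof.
pose h (i : 'I_N.+2) : {poly {poly S}} :=
  if unlift ord0 i is Some j then
    if unlift ord0 j is Some k then ('X_(k : 'I_N) : S)%:P%:P else 'X%:P * 'X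
  else 'X.
pose c : {rmorphism D -> {poly {poly S}}} := polyC \o (polyC \o @mpolyC N D).
pose g (k : 'I_N) : R := 'X_(lift ord0 (lift ord0 k)).
exists (mmap c h), (mmap (@mpolyC N.+2 D) g).
have hX i : mmap c h 'X_i = h i by rewrite mmapX mmap1U.
split.
  split=> [d|]; first exact: mmapC.
  split; first by apply: etrans (hX _) _; rewrite /h unlift_none.
  split; first by apply: etrans (hX _) _; rewrite /h liftK unlift_none.
  by move=> k; apply: etrans (hX _) _; rewrite /h !liftK.
by split=> [d|k]; [exact: mmapC|rewrite /= mmapX mmap1U].
Qed.

Variables (phi : {rmorphism R -> {poly {poly S}}}) (psi : {rmorphism S -> R}).
Hypothesis phi_const : forall c, phi c%:MP = c%:MP%:P%:P.
Hypothesis phi_x : phi 'X_ord0 = 'X.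
Hypothesis phi_y : phi 'X_(lift ord0 ord0) = 'X%:P * 'X.
Hypothesis phi_z : forall k : 'I_N, phi 'X_(lift ord0 (lift ord0 k)) = ('X_k : S)%:P%:P.
Hypothesis psi_const : forall c, psi c%:MP = c%:MP.
Hypothesis psi_z : forall k : 'I_N, psi 'X_k = 'X_(lift ord0 (lift ord0 k)).

Lemma dehom_embed c : phi (psi c) = c%:P%:P.
Proof.
move: c; apply: mpoly_ring_ind => [c|k|f g hf hg|f g hf hg].
- by rewrite psi_const phi_const.
- by rewrite psi_z phi_z.
- by rewrite !rmorphD /= hf hg.
- by rewrite !rmorphM /= hf hg.
Qed.

(* Every variable is [x = ord0], [y = lift ord0 ord0] or in the image of [psi]. *)
Lemma mpoly_xy_ind (K : R -> Prop) :
  (forall c, K (psi c)) -> K 'X_ord0 -> K 'X_(lift ord0 ord0) ->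
  (forall f g, K f -> K g -> K (f + g)) -> (forall f g, K f -> K g -> K (f * g)) ->
  forall f, K f.
Proof.
move=> KE Kx Ky KD KM; apply: mpoly_ring_ind => [c|i||//].
- by rewrite -psi_const.
- case: (unliftP ord0 i) => [j|] -> //; case: (unliftP ord0 j) => [k|] -> //.
  by rewrite -psi_z.
- exact: KD.
Qed.

(** Every [Y] comes with a factor [T], so [T ^ d] carries at most [Y ^ d]. *)
Lemma dehom_size f d : (size ((phi f)`_d)%R <= d.+1)%N.
Proof.
move: f d; apply: mpoly_xy_ind => [c|||f g hf hg|f g hf hg] d.
- rewrite dehom_embed coefC; case: d => [|d]; last by rewrite size_poly0.
  exact: size_polyC_leq1.
- rewrite phi_x coefX; case: eqP => _; last by rewrite size_poly0.
  by rewrite size_poly1.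
- rewrite phi_y coefCM coefX; case: eqP => [->|_]; last by rewrite mulr0 size_poly0.
  by rewrite mulr1 size_polyX.
- rewrite rmorphD coefD; apply: leq_trans (size_polyD _ _) _.
  by rewrite geq_max hf hg.
- rewrite rmorphM coefM; apply: leq_trans (size_sum _ _ _) _.
  apply/bigmax_leqP => i _; apply: leq_trans (size_polyMleq _ _) _.
  by have := hf i; have := hg (d - i)%N; have := ltn_ord i; lia.
Qed.

Lemma dehom_mod f : exists u v,
  f = psi (phi f)`_0`_0 + u * 'X_ord0 + v * 'X_(lift ord0 ord0).
Proof.
move: f; apply: mpoly_xy_ind => [c|||f g|f g].
- by exists 0, 0; rewrite dehom_embed !coefC !mul0r !addr0.
- by exists 1, 0; rewrite phi_x coefX coef0 rmorph0 mul0r mul1r add0r addr0.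
- exists 0, 1; rewrite phi_y coefCM coefX mulr0 coef0 rmorph0.
  by rewrite mul0r mul1r !add0r.
- move=> [u [v e]] [u' [v' e']]; exists (u + u'), (v + v').
  by rewrite rmorphD !coefD rmorphD {1}e {1}e' /=; ring.
move=> [u [v e]] [u' [v' e']]; rewrite rmorphM !coef0M rmorphM /=.
move: e e'; set c := psi _; set c' := psi _ => e e'.
exists (u * g + c * u'), (v * g + c * v').
by rewrite {1}e e'; ring.
Qed.
End Dehomogenization.

(** * Application to the given polynomial ring *)

Theorem theorem3p5 (D : idomainType) (N : nat) (hN : (1 < N)%N)
  (hBF : IR_is_BF {mpoly D[N]})
  (n : nat) (hn : (2 <= n)%N) (a : nat -> nat)
  (hpos : forall i, (1 <= i <= n.+1)%N -> (0 < a i)%N)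
  (C1 : a n.+1 = ((\sum_(1 <= i < n) a i) + 2 * a n)%N)
  (C2 : forall i, (1 <= i <= n.-1)%N -> (2 * (\sum_(1 <= j < i.+1) a j) < a i.+1)%N)
  (m : nat) (hm_in : inB a n m) (hm_max : forall b, inB a n b -> (b <= m)%N) :
  let mu := aint a n.+1 in
  let IB := @mono_ideal D N hN (inB a n) m in
  let IC := @mono_ideal D N hN (inC a n) mu in
  is_atom IB /\
  (in_lengths IC 2 /\ in_lengths IC n.+1 /\
   forall k, in_lengths IC k -> (2 <= k <= n.+1)%N).
Proof.
(* At index 1 this is positivity of [a 1]; from index 2 on it is [C2] shifted by one. *)
have a_super : superincreasing a n.+1.
  move=> [|[|i]] // ilt; first by rewrite big_geq // hpos.
  by apply: C2; lia.
have -> : m = (\sum_(1 <= i < n) a i + a n.+1)%N.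
  apply/eqP; rewrite eqn_leq (inB_le hn C1 hm_in) hm_max //.
  exact: inB_max.
(* Writing the number of variables as [N.+2] separates [X] and [Y] from the others. *)
move: {hBF} hN; case: N => [|[|N]] // hN mu IB IC.
have ex : varX hN = ord0 by apply: val_inj.
have ey : varY hN = lift ord0 ord0 by apply: val_inj.
rewrite /IB /IC /mono_ideal ex ey.
have [phi [psi [[phiC [phi_x [phi_y phi_z]]] [psiC psi_z]]]] := ex_dehomogenization D N.
have phi_psi := dehom_embed phiC phi_z psiC psi_z.
have phi_size := dehom_size phiC phi_x phi_y phi_z psiC psi_z.
have mod_xy := dehom_mod phiC phi_x phi_y phi_z psiC psi_z.
exact: (atom_and_lengths phi_psi phi_x phi_y phi_size mod_xy hn a_super C1).
Qed.
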